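(* Let $X=(X_t,t\ge 0)$ be a Lévy process in $\mathbb{R}^d$ without Gaussian component, with characteristic exponent determined by $b\in\mathbb{R}^d$ and Lévy measure $\nu\not\equiv 0$ as in the context. Let $f:\mathbb{R}^d\to\mathbb{R}$ be a 1-Lipschitz function with respect to the Euclidean norm, and let $c>0$. Then, for every $t>0$ such that $$t\,\overline{\nu}(h_c(t))\le \frac14,$$ any median $mf(X_t)$ of $f(X_t)$ satisfies $$|mf(X_t)-f(0)|\le h_c(t)\left[1+3g_c(1/4)\right]+E_c(t),$$ where $g_c(x)$ is the solution in $y$ of the equation $$y-(y+c)\log\left(1+\frac{y}{c}\right)=\log(x),$$ and where $$E_c(t)=t\sqrt{\sum_{k=1}^d\left(\langle e_k,b\rangle-\int_{h_c(t)<\|y\|\le 1}\langle e_k,y\rangle\,\nu(dy)+\int_{1<\|y\|\le h_c(t)}\langle e_k,y\rangle\,\nu(dy)\right)^2},$$ $e_1,\ldots,e_d$ being the canonical basis of $\mathbb{R}^d$.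
   Context: $\langle\cdot,\cdot\rangle$ and $\|\cdot\|$ are the Euclidean inner product and norm on $\mathbb{R}^d$. The law of the Lévy process $X$ (with $X_0=0$) is given by $\mathbb{E}\exp(i\langle u,X_t\rangle)=\exp(t\psi_X(u))$ for $u\in\mathbb{R}^d$, $t\ge 0$, where $$\psi_X(u)=i\langle u,b\rangle+\int_{\mathbb{R}^d}\left(e^{i\langle u,y\rangle}-1-i\langle u,y\rangle\mathbf{1}_{\|y\|\le 1}\right)\nu(dy),$$ with $b\in\mathbb{R}^d$ and $\nu\not\equiv 0$ a positive Borel measure on $\mathbb{R}^d$ without atom at the origin satisfying $\int(\|y\|^2\wedge 1)\,\nu(dy)<+\infty$. For $R>0$ put $V(R)=\int_{\|x\|\le R}\|x\|^2\,\nu(dx)$ and $\overline{\nu}(R)=\int_{\|x\|>R}\nu(dx)$. For $c,t>0$ put $$h_c(t)=\inf\left\{x>0:\frac{V(x)}{x^2}=\frac{c}{t}\right\};$$ only those $t$ are considered for which $h_c(t)\in(0,\infty)$, so that the expressions involving $h_c(t)$ are meaningful. For $c>0$ and $0<x\le 1$, $g_c(x)$ denotes the nonnegative solution $y\ge 0$ of its defining equation (the left-hand side is a decreasing bijection of $[0,\infty)$ onto $(-\infty,0]$). A median $m$ of a real random variable $W$ is a real number with $\mathbb{P}(W\le m)\ge 1/2$ and $\mathbb{P}(W\ge m)\ge 1/2$. A function $f$ is 1-Lipschitz if $|f(x)-f(y)|\le\|x-y\|$ for all $x,y$. *)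

(* Defs.v *)
(* MathComp-Analysis, over an arbitrary R : realType; complex numbers are R[i]
   from mathcomp-real-closed. *)
From HB Require Import structures.
From mathcomp Require Import all_boot all_order all_algebra.
From mathcomp Require Import complex.
From mathcomp Require Import all_classical all_reals all_analysis.

Set Implicit Arguments.
Unset Strict Implicit.
Unset Printing Implicit Defensive.

Import Order.TTheory GRing.Theory Num.Theory.
Import numFieldNormedType.Exports.

Local Open Scope classical_set_scope.
Local Open Scope ring_scope.
Local Open Scope complex_scope.

(* R^d with its Borel sigma-algebra.  The library norm on 'rV[R]_d is the sup
   norm; it induces the same topology as the Euclidean norm enorm below. *)
Notation Rvec R d := (g_sigma_algebraType (@open 'rV[R]_d)).

Section euclidean.
Context {R : realType} {d : nat}.
Implicit Types u v : 'rV[R]_d.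

Definition inner u v : R := \sum_(k < d) u ord0 k * v ord0 k.

Definition enorm u : R := Num.sqrt (inner u u).

Definition canonical_vec (k : 'I_d) : 'rV[R]_d := delta_mx ord0 k.

Definition lipschitz1 (f : 'rV[R]_d -> R) : Prop :=
  forall x y, `|f x - f y| <= enorm (x - y).

End euclidean.

Section complex_analysis.
Context {R : realType}.

Definition cexp (z : R[i]) : R[i] :=
  (expR (complex.Re z) * cos (complex.Im z))
    +i* (expR (complex.Re z) * sin (complex.Im z)).

Definition cintegral {disp} {T : measurableType disp}
    (mu : {measure set T -> \bar R}) (f : T -> R[i]) : R[i] :=
  (\int[mu]_x complex.Re (f x)) +i* (\int[mu]_x complex.Im (f x)).

End complex_analysis.

Section levy_process.
Context {R : realType} {d : nat} {disp : measure_display}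
  {T : measurableType disp}.
Variable P : probability T R.

(* Mutual independence.  As the sets A i are arbitrary, possibly the whole
   space, the product rule for subfamilies is included. *)
Definition independent_vecs (n : nat) (Y : 'I_n -> T -> 'rV[R]_d) : Prop :=
  forall A : 'I_n -> set (Rvec R d), (forall i, measurable (A i)) ->
    P (\bigcap_(i in [set: 'I_n]) (Y i @^-1` A i)) =
    (\prod_(i < n) P (Y i @^-1` A i))%E.

Definition cadlag (x : R -> 'rV[R]_d) : Prop :=
  (forall t : R, 0 <= t -> x s @[s --> t^'+] --> x t) /\
  (forall t : R, 0 < t -> cvg (x s @[s --> t^'-])).

(* The time set is [0, +oo[: the values X t for t < 0 are unconstrained and
   never used. *)
Variable X : R -> {RV P >-> Rvec R d}.

Definition increment (s t : R) (w : T) : 'rV[R]_d :=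
  (X t w : 'rV[R]_d) - (X s w : 'rV[R]_d).

Record levy_process : Prop := LevyProcess {
  levy_start : {ae P, forall w, X 0 w = 0 :> 'rV[R]_d} ;
  levy_independent : forall (n : nat) (s : nat -> R), 0 <= s 0 ->
    (forall i, (i < n)%N -> s i <= s i.+1) ->
    independent_vecs (fun i : 'I_n => increment (s i) (s i.+1)) ;
  levy_stationary : forall (s t : R) (A : set (Rvec R d)), 0 <= s -> 0 <= t ->
    measurable A ->
    P (increment s (s + t) @^-1` A) = P (increment 0 t @^-1` A) ;
  levy_stochastic_continuity : forall t eps : R, 0 <= t -> 0 < eps ->
    P [set w | eps < enorm (increment t s w)]
      @[s --> within [set s | 0 <= s] (nbhs t)] --> 0%E ;
  levy_cadlag : {ae P, forall w, cadlag (fun t => X t w)}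
}.

End levy_process.

Section levy_measure.
Context {R : realType} {d : nat}.
Variable nu : {measure set (Rvec R d) -> \bar R}.

Record levy_measure : Prop := LevyMeasure {
  levy_measure_atom0 : nu [set 0] = 0%E ;
  levy_measure_int :
    (\int[nu]_y (Num.min (enorm y ^+ 2) 1)%:E < +oo)%E
}.

Definition levy_exponent (b u : 'rV[R]_d) : R[i] :=
  'i%C * (inner u b)%:C +
  cintegral nu (fun y : Rvec R d =>
    cexp ('i%C * (inner u y)%:C) - 1
    - 'i%C * (inner u y * \1_[set z : 'rV[R]_d | enorm z <= 1] y)%:C).

Definition trunc_var (r : R) : R :=
  \int[nu]_(y in [set y : Rvec R d | enorm y <= r]) (enorm y ^+ 2).

Definition tail (r : R) : \bar R := nu [set y : Rvec R d | r < enorm y].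

(* The infimum is taken in the extended reals, so that it is +oo when no
   solution exists. *)
Definition hc (c t : R) : \bar R :=
  ereal_inf
    [set x%:E | x in [set x : R | 0 < x /\ trunc_var x / x ^+ 2 = c / t]].

Definition Ec (b : 'rV[R]_d) (t h : R) : R :=
  t * Num.sqrt (\sum_(k < d)
    (inner (canonical_vec k) b
     - \int[nu]_(y in [set y : Rvec R d | h < enorm y <= 1])
          inner (canonical_vec k) y
     + \int[nu]_(y in [set y : Rvec R d | 1 < enorm y <= h])
          inner (canonical_vec k) y) ^+ 2).

End levy_measure.

(* X has no Gaussian component, drift b and jump measure nu. *)
Definition levy_triplet {R : realType} {d : nat} {disp : measure_display}
    {T : measurableType disp} (P : probability T R)
    (X : R -> {RV P >-> Rvec R d}) (b : 'rV[R]_d)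
    (nu : {measure set (Rvec R d) -> \bar R}) : Prop :=
  forall (u : 'rV[R]_d) (t : R), 0 <= t ->
    cintegral P (fun w => cexp ('i%C * (inner u (X t w))%:C)) =
    cexp (t%:C * levy_exponent nu b u).

(* For c > 0 and 0 < x <= 1 the solution y exists and is unique. *)
Definition gc {R : realType} (c x : R) : R :=
  xget 0 [set y : R | 0 <= y /\ y - (y + c) * ln (1 + y / c) = ln x].

Definition is_median {R : realType} {disp : measure_display}
    {T : measurableType disp} (P : probability T R) (W : T -> R) (m : R) :=
  (2^-1%:E <= P [set w | (W w <= m)%R])%E /\
  (2^-1%:E <= P [set w | (m <= W w)%R])%E.

(* Main.v *)
Require Import Defs.
From HB Require Import structures.
From mathcomp Require Import all_boot all_order all_algebra.
From mathcomp Require Import complex ring lra.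
From mathcomp Require Import all_classical all_reals all_analysis.
From mathcomp Require Import measurable_realfun.

Set Implicit Arguments.
Unset Strict Implicit.
Unset Printing Implicit Defensive.

Import Order.TTheory GRing.Theory Num.Theory.
Import numFieldNormedType.Exports.

Local Open Scope classical_set_scope.
Local Open Scope ring_scope.

(** The median is controlled by a tail bound alone.  Write g for g_c(1/4), let
    D be the drift of X once the jumps are cut off at h = h_c(t) instead of 1,
    and W = X_t - t D; then E_c(t) = t |D|.  If P(|W| > 3 h g) < 1/2, then
    |f(X_t) - f(0)| <= |X_t| <= 3 h g + E_c(t) with probability above 1/2, and
    both half-lines that define a median must meet that range
    ([median_lipschitz1]).

    Heuristically X_t splits into the jumps larger than h, absent with
    probability at least 1 - t nu(|y| > h) >= 3/4, and a remainder with mean t D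
    and variance t V(h) = h^2 c.  Since g_c(1/4)^2 >= 2 c ln 4 ([gc_sqr_ge]),
    the radius 3 h g is several standard deviations of the remainder.

    The tail bound itself is read off from the characteristic function of X_t.
    Averaging cos <u,y> over a Gaussian vector u of covariance s Id gives
    exp (- s |y|^2 / 2), so that P(|W| > r) is bounded by the average over u of
    1 - E cos <u,W>, up to the factor 1 / (1 - exp (- s r^2 / 2)).  By the
    Levy-Khintchine formula
    ([centered_cf]) the integrand is controlled by t times the integrals of
    1 - cos <u,y> and of the phase terms against nu: the small jumps contribute
    a multiple of t <u,y>^2, which averages to s t V(h) whatever the dimension,
    and the large jumps at most their total mass ([sign_average_centered_cf]).
    The value s = 1 / (6 h^2 c) brings the probability below 1/2
    ([centered_tail_lt_half]).

    In place of the Gaussian vector, u is a finite sum of scaled basis vectors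
    with random signs.  The average of cos <u,y> is then a product of cosines,
    which is nonnegative and below the Gaussian factor on any prescribed ball
    ([gaussian_directions]).  That is enough for [tail_le_of_cf], and averages
    over u become finite sums, which commute with the integrals against nu
    and P. *)

(** * Elementary real inequalities *)

Section real_inequalities.
Context {R : realType}.
Implicit Types x y c : R.

Lemma ge0_of_derive_ge0 (f f' : R -> R) x : 0 <= x -> f 0 = 0 ->
  (forall y, 0 <= y <= x -> is_derive y 1 f (f' y)) ->
  (forall y, 0 <= y <= x -> 0 <= f' y) -> 0 <= f x.
Proof.
move=> x0 f0 df f'0; rewrite -f0.
have itvW y : y \in `]0, x[%R -> 0 <= y <= x.
  by rewrite in_itv/= => /andP[/ltW -> /ltW].
apply: (@ger0_derive1_ndecr R f 0 x) => //.
- by move=> y /itvW /df[].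
- move=> y /itvW y0x; rewrite derive1E; have [_ ->] := df _ y0x.
  exact: f'0.
- apply: continuous_in_subspaceT => y; rewrite inE/= in_itv/= => /df[? _].
  exact/differentiable_continuous/derivable1_diffP.
Qed.

Lemma sin_le x : 0 <= x -> sin x <= x.
Proof.
move=> x0; rewrite -subr_ge0.
apply: (@ge0_of_derive_ge0 (fun x => x - sin x) (fun x => 1 - cos x)).
- by [].
- by rewrite sin0 subr0.
- by move=> y _; rewrite subr_ge0 cos_le1.
Qed.

Lemma onem_cos_le x : 1 - cos x <= x ^+ 2 / 2.
Proof.
wlog x0 : x / 0 <= x => [H|].
  case: (leP 0 x) => [|/ltW] x0; first exact: H.
  by rewrite -cosN -sqrrN; apply: H; rewrite oppr_ge0.
rewrite -subr_ge0.
apply: (@ge0_of_derive_ge0 (fun x => x ^+ 2 / 2 - (1 - cos x))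
  (fun x => x - sin x)) => //.
- by rewrite cos0; lra.
- move=> y _; apply: is_derive_eq; rewrite /GRing.scale/=; lra.
- by move=> y /andP[y0 _]; rewrite subr_ge0 sin_le.
Qed.

Lemma normr_sinB_le x : `|sin x - x| <= x ^+ 2 / 2.
Proof.
wlog x0 : x / 0 <= x => [H|].
  case: (leP 0 x) => [|/ltW] x0; first exact: H.
  have := H (- x); rewrite sinN -opprD normrN sqrrN; apply.
  by rewrite oppr_ge0.
rewrite ler0_norm ?subr_le0 ?sin_le// opprB -subr_ge0.
apply: (@ge0_of_derive_ge0 (fun x => x ^+ 2 / 2 - (x - sin x))
  (fun x => x - (1 - cos x))) => //.
- by rewrite sin0; lra.
- move=> y _; apply: is_derive_eq; rewrite /GRing.scale/=; lra.
move=> y /andP[y0 _].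
apply: (@ge0_of_derive_ge0 (fun x => x - (1 - cos x))
  (fun x => 1 - sin x)).
- by [].
- by rewrite cos0; lra.
- move=> z _; apply: is_derive_eq; lra.
- by move=> z _; rewrite subr_ge0 sin_le1.
Qed.

Lemma normr_sin_le x : `|sin x| <= `|x|.
Proof.
wlog x0 : x / 0 <= x => [H|].
  case: (leP 0 x) => [|/ltW] x0; first exact: H.
  by rewrite -normrN -sinN -[`|x|]normrN; apply: H; rewrite oppr_ge0.
rewrite (ger0_norm x0) ler_norml sin_le// andbT lerNl -subr_ge0.
apply: (@ge0_of_derive_ge0 (fun x => x - - sin x) (fun x => 1 - - cos x)).
- by [].
- by rewrite sin0; lra.
- by move=> z _; have := cos_geN1 z; lra.
Qed.

Lemma cos_sub_le x y : cos x - cos y <= `|x - y|.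
Proof.
have -> : cos x - cos y = - 2 * sin ((x - y) / 2) * sin ((x + y) / 2).
  have E a b : cos (a + b) - cos (a - b) = - 2 * sin b * sin a :> R.
    by rewrite cosD cosB; ring.
  by rewrite -E; congr (cos _ - cos _); lra.
rewrite (le_trans (ler_norm _))// !normrM normrN normr_nat.
have -> : `|x - y| = 2 * `|(x - y) / 2| * 1.
  by rewrite normrM (@gtr0_norm _ (2^-1))//; lra.
apply: ler_pM => //; last by exact: sin_max.
by rewrite ler_pM2l// normr_sin_le.
Qed.

(** The derivative of cos x * exp (x^2 / 2) has the sign of x cos x - sin x,
    which is nonpositive near 0.  This is what turns a product of cosines into
    a Gaussian factor. *)
Lemma cos_le_expR x : `|x| <= 1 -> 0 <= cos x <= expR (- (x ^+ 2 / 2)).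
Proof.
wlog x0 : x / 0 <= x => [H|].
  case: (leP 0 x) => [|/ltW] x0; first exact: H.
  by rewrite -normrN -cosN -sqrrN; apply: H; rewrite oppr_ge0.
rewrite (ger0_norm x0) => x1; apply/andP; split.
  have := onem_cos_le x; suff : x ^+ 2 <= 1 by lra.
  by rewrite expr_le1.
rewrite expRN -[leRHS]div1r ler_pdivlMr ?expR_gt0// -subr_ge0.
pose g z : R := sin z - z * cos z.
apply: (@ge0_of_derive_ge0 (fun x => 1 - cos x * expR (x ^+ 2 / 2))
  (fun x => expR (x ^+ 2 / 2) * g x)) => //.
- by rewrite cos0 expr0n/= mul0r expR0; lra.
- move=> y _; apply: is_derive_eq; rewrite /GRing.scale/= /g; by field.
move=> y /andP[y0 yx]; rewrite mulr_ge0 ?expR_ge0//.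
apply: (@ge0_of_derive_ge0 g (fun x => x * sin x)) => //.
- by rewrite /g sin0; ring.
- move=> z _; apply: is_derive_eq; rewrite /GRing.scale/=; ring.
move=> z /andP[z0 zy]; rewrite mulr_ge0//.
have [->|zn0] := eqVneq z 0; first by rewrite sin0.
by apply/ltW/sin2_gt0; rewrite lt0r zn0 z0/=; lra.
Qed.

Lemma onemMln1D_le x : 0 <= x -> (1 + x) * ln (1 + x) - x <= x ^+ 2 / 2.
Proof.
move=> x0; rewrite -subr_ge0.
apply: (@ge0_of_derive_ge0
  (fun x => x ^+ 2 / 2 - ((1 + x) * ln (1 + x) - x))
  (fun x => x - ln (1 + x))) => //.
- by rewrite addr0 ln1; ring.
- move=> y /andP[y0 _]; have y1 : 0 < 1 + y by lra.
  have dln := is_derive1_ln y1.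
  apply: is_derive_eq; rewrite /GRing.scale/=; field; lra.
- move=> y /andP[y0 _]; rewrite subr_ge0 le_ln1Dx//; lra.
Qed.

(** The tangent line of exp at -1/3, using exp (-1/3) >= (5/6)^2.  Being affine
    in a, it can be averaged; 1/3 is the value of the average to which it is
    applied in [sign_average_centered_cf]. *)
Lemma expRN_ge_tangent (a : R) : 25 / 36 * (4 / 3 - a) <= expR (- a).
Proof.
have [a43|a43] := leP (4 / 3) a.
  by apply: (@le_trans _ _ 0); [lra|exact: expR_ge0].
have e6 : 5 / 6 <= expR (- (1 / 6)) :> R.
  by have := expR_ge1Dx (- (1 / 6) : R); lra.
have e3 : 25 / 36 <= expR (- (1 / 3)) :> R.
  have -> : - (1 / 3) = - (1 / 6) + - (1 / 6) :> R by lra.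
  by rewrite expRD; nra.
have := expR_ge1Dx (1 / 3 - a) => e1.
have -> : - a = - (1 / 3) + (1 / 3 - a) by ring.
rewrite expRD; apply: ler_pM => //; lra.
Qed.

End real_inequalities.

(** * The function g_c *)

Section deviation_function.
Context {R : realType}.
Implicit Types x y c : R.

(** The intermediate value theorem provides the solution that [gc] selects. *)
Lemma gcP c x : 0 < c -> 0 < x -> x <= 1 ->
  0 <= gc c x /\ gc c x - (gc c x + c) * ln (1 + gc c x / c) = ln x.
Proof.
move=> c0 x0 x1.
suff /(xgetPex 0)[] : exists y : R,
  0 <= y /\ y - (y + c) * ln (1 + y / c) = ln x.
  by [].
have lx : ln x <= 0 by rewrite ln_le0.
pose F (y : R) : R := y - (y + c) * ln (1 + y / c).
(* With 1 + Y / c = exp L the equation at Y is -c (exp L (L - 1) + 1), which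
   falls below ln x as soon as L - 1 >= - ln x / c. *)
pose L := 1 - ln x / c; pose Y := c * (expR L - 1).
have lxc : 0 <= - ln x / c by rewrite divr_ge0 ?oppr_ge0// ltW.
have L1 : 1 <= L by rewrite /L -mulNr; lra.
have Y0 : 0 <= Y.
  rewrite mulr_ge0 ?(ltW c0)//; have := expR_ge1Dx L; lra.
have F0 : F 0 = 0 by rewrite /F mul0r addr0 ln1 mulr0 subr0.
have FY : F Y <= ln x.
  have e1 : 1 + Y / c = expR L by rewrite /Y mulrAC divff ?gt_eqF//; ring.
  rewrite /F e1 expRK.
  have -> : ln x = - (c * (L - 1)).
    by rewrite /L; field; rewrite gt_eqF.
  have : 0 <= c * ((expR L - 1) * (L - 1)).
    rewrite !mulr_ge0 ?(ltW c0)//; have := expR_ge1Dx L; lra.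
  rewrite /Y; lra.
have cF : {within `[0, Y], continuous F}.
  apply: continuous_in_subspaceT => z; rewrite inE/= in_itv/= => /andP[z0 _].
  apply/differentiable_continuous/derivable1_diffP.
  have z1 : 0 < 1 + z / c by rewrite ltr_pwDl// divr_ge0// ltW.
  have dln := is_derive1_ln z1.
  exact: ex_derive.
have vF : Num.min (F 0) (F Y) <= ln x <= Num.max (F 0) (F Y).
  by rewrite F0 ge_min le_max lx FY orbT.
have [y yY Fy] := IVT Y0 cF vF.
exists y => //; split => //.
by move: yY; rewrite in_itv/= => /andP[].
Qed.

(** With y = g_c(x), the defining equation reads
    c ((1 + y/c) ln (1 + y/c) - y/c) = - ln x, whose left-hand side is at most
    y^2 / (2 c).  So g_c(x) dominates the Gaussian quantile sqrt (2 c ln (1/x)),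
    and in particular a standard deviation sqrt c. *)
Lemma gc_sqr_ge c x : 0 < c -> 0 < x -> x <= 1 ->
  2 * c * - ln x <= gc c x ^+ 2.
Proof.
move=> c0 x0 x1; have [g0 <-] := gcP c0 x0 x1; set g := gc c x.
have gc0 : 0 <= g / c by rewrite divr_ge0// ltW.
have := ler_wpM2l (ltW c0) (onemMln1D_le gc0).
have -> : c * ((1 + g / c) * ln (1 + g / c) - g / c) =
          - (g - (g + c) * ln (1 + g / c)) by field; rewrite gt_eqF.
have -> : c * ((g / c) ^+ 2 / 2) = g ^+ 2 / (2 * c).
  by field; rewrite gt_eqF.
rewrite ler_pdivlMr ?mulr_gt0// => H.
lra.
Qed.

End deviation_function.

(** * Euclidean geometry *)

Section euclidean_theory.
Context {R : realType} {d : nat}.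
Implicit Types u v w : 'rV[R]_d.

Lemma innerC u v : inner u v = inner v u.
Proof. by apply: eq_bigr => k _; rewrite mulrC. Qed.

Lemma innerDl u v w : inner (u + v) w = inner u w + inner v w.
Proof. by rewrite -big_split; apply: eq_bigr => k _; rewrite mxE mulrDl. Qed.

Lemma innerZl a u v : inner (a *: u) v = a * inner u v.
Proof. by rewrite mulr_sumr; apply: eq_bigr => k _; rewrite mxE mulrA. Qed.

Lemma innerBl u v w : inner (u - v) w = inner u w - inner v w.
Proof. by rewrite -scaleN1r innerDl innerZl mulN1r. Qed.

Lemma inner0l v : inner 0 v = 0.
Proof. by rewrite -(subrr v) innerBl subrr. Qed.

Lemma innerZr a u v : inner u (a *: v) = a * inner u v.
Proof. by rewrite innerC innerZl innerC. Qed.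

Lemma innerBr u v w : inner w (u - v) = inner w u - inner w v.
Proof. by rewrite innerC innerBl !(innerC w). Qed.

Lemma inner_canonical_vec k u : inner (canonical_vec k) u = u ord0 k.
Proof.
rewrite /inner (bigD1 k)//= !mxE !eqxx mul1r big1 ?addr0// => j jk.
by rewrite mxE (negbTE jk) andbF mul0r.
Qed.

Lemma inner_ge0 u : 0 <= inner u u.
Proof. by apply: sumr_ge0 => k _; rewrite -expr2 sqr_ge0. Qed.

Lemma inner_gt0 u : u != 0 -> 0 < inner u u.
Proof.
move=> u0; rewrite lt0r inner_ge0 andbT; apply: contra u0 => /eqP.
move=> /psumr_eq0P uu; apply/eqP/rowP => k; rewrite mxE; apply/eqP.
by rewrite -sqrf_eq0 expr2 uu// => j _; rewrite -expr2 sqr_ge0.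
Qed.

Lemma sqr_enorm u : enorm u ^+ 2 = inner u u.
Proof. by rewrite sqr_sqrtr ?inner_ge0. Qed.

Lemma enorm_ge0 u : 0 <= enorm u.
Proof. exact: sqrtr_ge0. Qed.

Lemma enorm0 : enorm (0 : 'rV[R]_d) = 0.
Proof. by rewrite /enorm inner0l sqrtr0. Qed.

Lemma enormZ a u : enorm (a *: u) = `|a| * enorm u.
Proof.
by rewrite /enorm innerZl innerZr mulrA -expr2 sqrtrM ?sqr_ge0// sqrtr_sqr.
Qed.

Lemma enormB u v : enorm (u - v) = enorm (v - u).
Proof. by rewrite -opprB -scaleN1r enormZ normrN1 mul1r. Qed.

(** Cauchy-Schwarz, by expanding the square norm of <v,v> u - <u,v> v. *)
Lemma inner_sqr_le u v : inner u v ^+ 2 <= enorm u ^+ 2 * enorm v ^+ 2.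
Proof.
rewrite !sqr_enorm; have [->|v0] := eqVneq v 0.
  by rewrite innerC inner0l expr0n mulr_ge0 ?inner_ge0.
have vv := inner_gt0 v0; rewrite -subr_ge0 -(pmulr_rge0 _ vv).
have := inner_ge0 (inner v v *: u - inner u v *: v).
rewrite innerBl !innerBr !innerZl !innerZr (innerC v u); lra.
Qed.

Lemma normr_inner_le u v : `|inner u v| <= enorm u * enorm v.
Proof.
rewrite -(@ler_pXn2r _ 2) ?nnegrE ?mulr_ge0 ?enorm_ge0//.
by rewrite real_normK ?num_real// exprMn inner_sqr_le.
Qed.

Lemma enormD u v : enorm (u + v) <= enorm u + enorm v.
Proof.
rewrite -(@ler_pXn2r _ 2) ?nnegrE ?addr_ge0 ?enorm_ge0//.
rewrite sqr_enorm innerDl innerC (innerC v) !innerDl -!sqr_enorm.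
have := le_trans (ler_norm _) (normr_inner_le u v); rewrite (innerC v u); lra.
Qed.

Lemma normr_coord_le u k : `|u ord0 k| <= enorm u.
Proof.
rewrite -sqrtr_sqr ler_wsqrtr// [leRHS](bigD1 k)//= -expr2 lerDl.
by apply: sumr_ge0 => j _; rewrite -expr2 sqr_ge0.
Qed.

Lemma inner_continuous u : continuous (inner u).
Proof.
apply: continuous_big; first exact: add_continuous.
move=> k _ v; apply: (@continuousM R _ (fun=> u ord0 k) (fun v => v ord0 k)).
  exact: (@cst_continuous 'rV[R]_d R (u ord0 k)).
exact: coord_continuous.
Qed.

Lemma enormB_continuous u : continuous (fun v => enorm (v - u)).
Proof.
move=> v; apply: (@continuous_comp _ _ _
  (fun v : 'rV[R]_d => inner (v - u) (v - u)) (@Num.sqrt R));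
  last exact: sqrt_continuous.
have -> : (fun v => inner (v - u) (v - u)) =
    (fun v => \sum_(k < d) (v ord0 k - u ord0 k) * (v ord0 k - u ord0 k)).
  by apply/funext => w; apply: eq_bigr => k _; rewrite !mxE.
have cB k : continuous (fun v : 'rV[R]_d => v ord0 k - u ord0 k).
  move=> w; apply: (@continuousB R _ _ (fun v : 'rV[R]_d => v ord0 k)
    (fun=> u ord0 k)); first exact: coord_continuous.
  exact: (@cst_continuous 'rV[R]_d R (u ord0 k)).
move: v; apply: continuous_big; first exact: add_continuous.
by move=> k _ v; apply: (@continuousM R _ (fun v => v ord0 k - u ord0 k)
  (fun v => v ord0 k - u ord0 k)); exact: cB.
Qed.

Lemma lipschitz1_continuous f : @lipschitz1 R d f -> continuous f.
Proof.
move=> lf x; have FF : Filter (nbhs x) := nbhs_filter x.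
apply/(@cvgrPdist_le _ _ _ (nbhs x) FF) => e e0.
have /(@cvgrPdist_le _ _ _ (nbhs x) FF)/(_ e e0) := @enormB_continuous x x.
apply: filterS => y; rewrite subrr enorm0 sub0r normrN => He.
by rewrite (le_trans (lf _ _))// enormB (le_trans (ler_norm _)).
Qed.

End euclidean_theory.

(** * Averages over random signs *)

Section sign_average.
Context {R : realType} {d : nat}.
Implicit Types (u v w : 'rV[R]_d) (L : seq 'rV[R]_d) (F G : 'rV[R]_d -> R).

(** The expectation of F at the random point that sums the vectors of L with
    independent fair signs.  Being a finite average, it commutes with
    integration against any measure. *)
Fixpoint sign_average L F : R :=
  if L is v :: L' then
    (sign_average L' (fun u => F (u + v)) +
     sign_average L' (fun u => F (u - v))) / 2
  else F 0.

Lemma eq_sign_average L F G : F =1 G -> sign_average L F = sign_average L G.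
Proof. by move=> /funext ->. Qed.

Lemma ler_sign_average L F G : (forall u, F u <= G u) ->
  sign_average L F <= sign_average L G.
Proof.
elim: L F G => [|v L IH] F G FG //=.
by rewrite ler_pM2r// lerD// IH.
Qed.

Lemma sign_average_cst L (k : R) : sign_average L (fun=> k) = k.
Proof. by elim: L => [|v L IH] //=; rewrite IH; lra. Qed.

Lemma sign_averageD L F G :
  sign_average L (fun u => F u + G u) = sign_average L F + sign_average L G.
Proof. by elim: L F G => [|v L IH] F G //=; rewrite !IH; lra. Qed.

Lemma sign_averageZ L k F :
  sign_average L (fun u => k * F u) = k * sign_average L F.
Proof. by elim: L F => [|v L IH] F //=; rewrite !IH; lra. Qed.

(** Each fair sign contributes (cos (a + b) + cos (a - b)) / 2 = cos a cos b. *)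
Lemma sign_average_cos L w :
  sign_average L (fun u => cos (inner u w)) = \prod_(v <- L) cos (inner v w).
Proof.
(* The induction needs an arbitrary starting point u0. *)
suff H u0 : sign_average L (fun u => cos (inner (u + u0) w)) =
    cos (inner u0 w) * \prod_(v <- L) cos (inner v w).
  have := H 0; rewrite inner0l cos0 mul1r => <-.
  by apply: eq_sign_average => u; rewrite addr0.
elim: L u0 => [|v L IH] u0 /=; first by rewrite add0r big_nil mulr1.
under eq_sign_average do rewrite -addrA.
under [X in _ + X]eq_sign_average do rewrite -addrA.
rewrite !IH big_cons innerDl innerDl -scaleN1r innerZl mulN1r.
rewrite cosD cosD cosN sinN; lra.
Qed.

(** The cross terms cancel: the second moment of a sum of independent centered
    variables is the sum of their second moments. *)
Lemma sign_average_sqr L w :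
  sign_average L (fun u => inner u w ^+ 2) = \sum_(v <- L) inner v w ^+ 2.
Proof.
suff H u0 : sign_average L (fun u => inner (u + u0) w ^+ 2) =
    inner u0 w ^+ 2 + \sum_(v <- L) inner v w ^+ 2.
  have := H 0; rewrite inner0l expr0n add0r => <-.
  by apply: eq_sign_average => u; rewrite addr0.
elim: L u0 => [|v L IH] u0 /=; first by rewrite add0r big_nil addr0.
under eq_sign_average do rewrite -addrA.
under [X in _ + X]eq_sign_average do rewrite -addrA.
rewrite !IH big_cons innerDl innerDl -scaleN1r innerZl mulN1r; lra.
Qed.

Lemma sign_average_Rintegral {disp} {T : measurableType disp}
    (mu : {measure set T -> \bar R}) (D : set T) L (F : 'rV[R]_d -> T -> R) :
  measurable D -> (forall u, mu.-integrable D (EFin \o F u)) ->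
  mu.-integrable D (EFin \o (fun y => sign_average L (F^~ y))) /\
  sign_average L (fun u => \int[mu]_(y in D) F u y) =
  \int[mu]_(y in D) sign_average L (F^~ y).
Proof.
move=> mD; elim: L F => [|v L IH] F iF //=.
have [i1 e1] := IH (fun u => F (u + v)) (fun u => iF _).
have [i2 e2] := IH (fun u => F (u - v)) (fun u => iF _).
have i12 : mu.-integrable D (EFin \o (fun y =>
    sign_average L (fun u => F (u + v) y) +
    sign_average L (fun u => F (u - v) y))).
  by have := integrableD mD i1 i2; apply: eq_integrable.
split.
  have := integrableZr mD (2^-1) i12; apply: eq_integrable => // y _.
by rewrite e1 e2 RintegralZr// RintegralD.
Qed.

End sign_average.

(** * Integrability against a Levy measure *)

Section levy_integrability.
Context {R : realType} {d : nat}.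
Implicit Types u y : 'rV[R]_d.

Lemma continuous_measurable_Rvec (f : 'rV[R]_d -> R) : continuous f ->
  measurable_fun [set: Rvec R d] (f : Rvec R d -> R).
Proof.
move=> /continuousP cf; apply: (measurability _ (RGenOpens.measurableE R)).
move=> _ [_ [a [b ->] <-]]; rewrite setTI.
by apply: sub_sigma_algebra; apply: cf; exact: interval_open.
Qed.

Lemma measurable_inner u :
  measurable_fun [set: Rvec R d] (inner u : Rvec R d -> R).
Proof. by apply: continuous_measurable_Rvec; exact: inner_continuous. Qed.

Lemma measurable_enormB u :
  measurable_fun [set: Rvec R d] ((fun y => enorm (y - u)) : Rvec R d -> R).
Proof. by apply: continuous_measurable_Rvec; exact: enormB_continuous. Qed.

Lemma measurable_enorm :
  measurable_fun [set: Rvec R d] (@enorm R d : Rvec R d -> R).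
Proof.
have := measurable_enormB 0; congr measurable_fun.
by apply/funext => y /=; rewrite subr0.
Qed.

Variable nu : {measure set (Rvec R d) -> \bar R}.
Hypothesis levy_nu : levy_measure nu.

Definition trunc_sqr y : R := Num.min (enorm y ^+ 2) 1.

Lemma trunc_sqr_ge0 y : 0 <= trunc_sqr y.
Proof. by rewrite le_min sqr_ge0 ler01. Qed.

Lemma measurable_trunc_sqr :
  measurable_fun [set: Rvec R d] (trunc_sqr : Rvec R d -> R).
Proof.
apply: measurable_minr; last exact: measurable_cst.
by apply: measurable_funX; exact: measurable_enorm.
Qed.

Lemma integrable_trunc_sqr : nu.-integrable [set: Rvec R d] (EFin \o trunc_sqr).
Proof.
apply/integrableP; split.
  by apply/measurable_EFinP; exact: measurable_trunc_sqr.
have [_] := levy_nu; congr (_ < _)%E; apply: eq_integral => y _ /=.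
by rewrite ger0_norm ?trunc_sqr_ge0.
Qed.

(** The criterion behind every integrability claim about nu below: comparison
    with min (|y|^2, 1), the function that a Levy measure integrates. *)
Lemma levy_integrable (D : set (Rvec R d)) (f : Rvec R d -> R) (k : R) :
  measurable D -> measurable_fun [set: Rvec R d] f ->
  (forall y, D y -> `|f y| <= k * trunc_sqr y) ->
  nu.-integrable D (EFin \o f).
Proof.
move=> mD mf fk.
have iK : nu.-integrable D (fun y => k%:E * (EFin \o trunc_sqr) y)%E.
  apply: integrableZl => //.
  by apply: integrableS integrable_trunc_sqr.
apply: le_integrable iK => //.
  by apply/measurable_EFinP; apply: measurable_funTS.
move=> y Dy /=; rewrite lee_fin (le_trans (fk _ Dy))// ler_norm//.
Qed.

Lemma sqr_enorm_le_trunc r y : enorm y <= r ->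
  enorm y ^+ 2 <= (1 + r ^+ 2) * trunc_sqr y.
Proof.
move=> yr; have r2 : enorm y ^+ 2 <= r ^+ 2.
  by rewrite ler_pXn2r ?nnegrE ?enorm_ge0// (le_trans _ yr)// enorm_ge0.
rewrite /trunc_sqr; case: (leP (enorm y ^+ 2) 1) => _; last first.
  by rewrite mulr1 ler_wpDl.
by rewrite ler_peMl ?sqr_ge0// lerDl sqr_ge0.
Qed.

Lemma one_le_trunc r y : 0 < r -> r <= enorm y ->
  1 <= (1 + r ^- 2) * trunc_sqr y.
Proof.
move=> r0 ry; have r2 : r ^+ 2 <= enorm y ^+ 2.
  by rewrite ler_pXn2r ?nnegrE ?enorm_ge0// ltW.
have r20 : 0 < r ^+ 2 by rewrite exprn_gt0.
have ri : 0 < r ^- 2 by rewrite invr_gt0.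
rewrite /trunc_sqr; case: (leP (enorm y ^+ 2) 1) => _; last first.
  by rewrite mulr1 lerDl ltW.
rewrite mulrDl -[leLHS]add0r lerD ?mul1r ?sqr_ge0//.
by rewrite mulrC ler_pdivlMr// mul1r.
Qed.

End levy_integrability.

(** * The drift and the exponent truncated at h *)

Section truncated_exponent.
Context {R : realType} {d : nat}.
Implicit Types u y : 'rV[R]_d.

Lemma Rintegral_sum {disp} {T : measurableType disp}
    (mu : {measure set T -> \bar R}) (D : set T) (I : Type) (s : seq I)
    (F : I -> T -> R) : measurable D ->
  (forall i, mu.-integrable D (EFin \o F i)) ->
  \int[mu]_(y in D) (\sum_(i <- s) F i y) =
  \sum_(i <- s) \int[mu]_(y in D) F i y.
Proof.
move=> mD iF; elim: s => [|i s IH].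
  under eq_Rintegral do rewrite big_nil.
  by rewrite big_nil Rintegral_cst// mul0r.
under eq_Rintegral do rewrite big_cons.
rewrite big_cons -IH RintegralD//.
have := integrable_sum mD s (P := xpredT) (fun i _ => iF i).
by apply: eq_integrable => // y _ /=; rewrite sumEFin.
Qed.

Variables (b : 'rV[R]_d) (nu : {measure set (Rvec R d) -> \bar R}) (h : R).
Hypotheses (levy_nu : levy_measure nu) (h0 : 0 < h).

Let small : set (Rvec R d) := [set y | enorm y <= h].
Let large : set (Rvec R d) := [set y | h < enorm y].

Lemma measurable_small : measurable small.
Proof.
rewrite (_ : small = (@enorm R d) @^-1` `]-oo, h]).
  by rewrite -[X in measurable X]setTI; apply: measurable_enorm.
by apply/seteqP; split => y; rewrite /small/= in_itv.
Qed.

Lemma measurable_large : measurable large.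
Proof.
rewrite (_ : large = ~` small); first last.
  by apply/seteqP; split => y; rewrite /small /large/= ltNge => /negP.
by apply: measurableC; exact: measurable_small.
Qed.

Lemma measurable_shell r s : measurable [set y : Rvec R d | r < enorm y <= s].
Proof.
rewrite (_ : mkset _ = (@enorm R d) @^-1` `]r, s]).
  by rewrite -[X in measurable X]setTI; apply: measurable_enorm.
by apply/seteqP; split => y; rewrite /= in_itv.
Qed.

Lemma small_large : small `|` large = setT.
Proof.
apply/seteqP; split => y // _; rewrite /small /large /=.
by case: leP; [left|right].
Qed.

Lemma disjoint_small_large : [disjoint small & large].
Proof.
rewrite disj_set2E; apply/eqP; rewrite -subset0 => y [/=].
by rewrite /small /large/= leNgt => /negP.
Qed.

Lemma measurable_cos_inner u :
  measurable_fun [set: Rvec R d] ((fun y => cos (inner u y)) : Rvec R d -> R).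
Proof.
apply: (measurableT_comp _ (measurable_inner u)).
by apply: continuous_measurable_fun; exact: continuous_cos.
Qed.

Lemma measurable_sin_inner u :
  measurable_fun [set: Rvec R d] ((fun y => sin (inner u y)) : Rvec R d -> R).
Proof.
apply: (measurableT_comp _ (measurable_inner u)).
by apply: continuous_measurable_fun; exact: continuous_sin.
Qed.

Lemma integrable_onem_cos (D : set (Rvec R d)) u : measurable D ->
  nu.-integrable D (EFin \o ((fun y => 1 - cos (inner u y)) : Rvec R d -> R)).
Proof.
move=> mD; apply: (levy_integrable levy_nu (k := enorm u ^+ 2 + 2)) => //.
  by apply: measurable_funB => //; exact: measurable_cos_inner.
move=> y _; rewrite ger0_norm ?subr_ge0 ?cos_le1//.
have /= le2 : 1 - cos (inner u y) <= 2 by have := cos_geN1 (inner u y); lra.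
have := onem_cos_le (inner u y); have := inner_sqr_le u y.
rewrite /trunc_sqr; case: (leP (enorm y ^+ 2) 1) => _.
  rewrite mulrDl.
  by have := sqr_ge0 (enorm y); have := sqr_ge0 (inner u y); lra.
by have := sqr_ge0 (enorm u); lra.
Qed.

Lemma integrable_sqr_inner u :
  nu.-integrable small (EFin \o ((fun y => inner u y ^+ 2) : Rvec R d -> R)).
Proof.
apply: (levy_integrable levy_nu (k := enorm u ^+ 2 * (1 + h ^+ 2))).
- exact: measurable_small.
- by apply: measurable_funX; exact: measurable_inner.
move=> y yh; rewrite ger0_norm ?sqr_ge0// (le_trans (inner_sqr_le _ _))//.
by rewrite -mulrA ler_wpM2l ?sqr_ge0// sqr_enorm_le_trunc.
Qed.

Lemma integrable_sinB_inner u : nu.-integrable small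
  (EFin \o ((fun y => sin (inner u y) - inner u y) : Rvec R d -> R)).
Proof.
apply: le_integrable (integrable_sqr_inner u).
- exact: measurable_small.
- apply/measurable_EFinP; apply: measurable_funTS.
  apply: measurable_funB; first exact: measurable_sin_inner.
  exact: measurable_inner.
move=> y _ /=; rewrite lee_fin (le_trans (normr_sinB_le _))//.
rewrite ger0_norm ?sqr_ge0//; have := sqr_ge0 (inner u y); lra.
Qed.

Lemma integrable_sin_inner u : nu.-integrable large
  (EFin \o ((fun y => sin (inner u y)) : Rvec R d -> R)).
Proof.
apply: (levy_integrable levy_nu (k := 1 + h ^- 2)).
- exact: measurable_large.
- exact: measurable_sin_inner.
by move=> y /ltW hy; rewrite (le_trans (sin_max _))// one_le_trunc.
Qed.

Lemma integrable_inner_shell r s u : 0 < r ->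
  nu.-integrable [set y : Rvec R d | r < enorm y <= s]
    (EFin \o (inner u : Rvec R d -> R)).
Proof.
move=> r0; apply: (levy_integrable levy_nu (k := enorm u * s * (1 + r ^- 2))).
- exact: measurable_shell.
- exact: measurable_inner.
move=> y /= /andP[/ltW ry ys].
have s0 : 0 <= s by rewrite (le_trans _ ys)// enorm_ge0.
rewrite (le_trans (normr_inner_le _ _))// -mulrA.
rewrite -[leLHS]mulr1 ler_pM ?mulr_ge0 ?enorm_ge0 ?one_le_trunc//.
by rewrite ler_wpM2l ?enorm_ge0.
Qed.

(** The drift for the cut-off at h in place of 1: t times it is the mean of the
    part of X_t that keeps only the jumps of size at most h. *)
Definition truncated_drift : 'rV[R]_d :=
  \row_k (inner (canonical_vec k) b
     - \int[nu]_(y in [set y : Rvec R d | h < enorm y <= 1])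
          inner (canonical_vec k) y
     + \int[nu]_(y in [set y : Rvec R d | 1 < enorm y <= h])
          inner (canonical_vec k) y).

Lemma EcE t : Ec nu b t h = t * enorm truncated_drift.
Proof.
by congr (_ * Num.sqrt _); apply: eq_bigr => k _; rewrite mxE expr2.
Qed.

Lemma inner_truncated_drift u : inner u truncated_drift = inner u b
  - \int[nu]_(y in [set y : Rvec R d | h < enorm y <= 1]) inner u y
  + \int[nu]_(y in [set y : Rvec R d | 1 < enorm y <= h]) inner u y.
Proof.
have lin r s : 0 < r ->
    \int[nu]_(y in [set y : Rvec R d | r < enorm y <= s]) inner u y =
    \sum_(k < d) u ord0 k *
      \int[nu]_(y in [set y : Rvec R d | r < enorm y <= s])
        inner (canonical_vec k) y.
  move=> r0; have i k := @integrable_inner_shell r s (canonical_vec k) r0.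
  have mS := @measurable_shell r s.
  rewrite (eq_bigr _ (fun k _ => esym (RintegralZl (u ord0 k) mS (i k)))).
  rewrite -Rintegral_sum//; last first.
    move=> k; have := integrableZl mS (u ord0 k) (i k).
    exact: eq_integrable.
  apply: eq_Rintegral => y _; apply: eq_bigr => k _.
  by rewrite inner_canonical_vec.
rewrite !lin// -sumrB -big_split/=; apply: eq_bigr => k _.
by rewrite mxE inner_canonical_vec mulrDr mulrBr.
Qed.

(** The exponent of X at u is
    i <u, drift> - cf_decay u + i (small_phase u + large_phase u). *)
Definition cf_decay u : R := \int[nu]_y (1 - cos (inner u y)).
Definition small_phase u : R :=
  \int[nu]_(y in small) (sin (inner u y) - inner u y).
Definition large_phase u : R := \int[nu]_(y in large) sin (inner u y).

End truncated_exponent.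

Section exponent.
Context {R : realType} {d : nat}.
Variables (b : 'rV[R]_d) (nu : {measure set (Rvec R d) -> \bar R}) (h : R).
Hypotheses (levy_nu : levy_measure nu) (h0 : 0 < h).
Implicit Types u y : 'rV[R]_d.

Let small : set (Rvec R d) := [set y | enorm y <= h].
Let large : set (Rvec R d) := [set y | h < enorm y].
Local Notation drift := (truncated_drift b nu h).
Local Notation A := (cf_decay nu).
Local Notation theta1 := (small_phase nu h).
Local Notation theta2 := (large_phase nu h).

Lemma cexp_iM (x : R) : cexp ('i%C * x%:C)%C = (cos x +i* sin x)%C.
Proof.
by rewrite /cexp; simpc; rewrite /= expR0 !mul1r.
Qed.

Lemma Re_levy_exponent u : complex.Re (levy_exponent nu b u) = - A u.
Proof.
rewrite /levy_exponent /cintegral; simpc => /=.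
transitivity (\int[nu]_(y in setT) (-1 * (1 - cos (inner u y)))).
  apply: eq_Rintegral => y _.
  rewrite !(mulr0, mul0r, subr0, add0r, mul1r, oppr0, expR0).
  ring.
by rewrite RintegralZl ?mulN1r//; exact: integrable_onem_cos.
Qed.

Lemma Rintegral_small_large (f : Rvec R d -> R) :
  nu.-integrable setT (EFin \o f) ->
  \int[nu]_y f y = \int[nu]_(y in small) f y + \int[nu]_(y in large) f y.
Proof.
move=> fi; rewrite -(small_large h) Rintegral_setU//.
- exact: measurable_small.
- exact: measurable_large.
- by rewrite small_large.
- exact: disjoint_small_large.
Qed.

Lemma integrable_patch (D : set (Rvec R d)) (f : Rvec R d -> R) :
  measurable D -> nu.-integrable D (EFin \o f) ->
  nu.-integrable setT (EFin \o (f \_ D)).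
Proof. by move=> mD /(integrable_mkcond _ mD); rewrite restrict_EFin. Qed.

(** Moving the cut-off from 1 to h adds <u,y> on the shell 1 < |y| <= h and
    removes it on the shell h < |y| <= 1, which is how the two drifts differ. *)
Lemma Im_levy_exponent u :
  complex.Im (levy_exponent nu b u) = inner u drift + theta1 u + theta2 u.
Proof.
rewrite /levy_exponent /cintegral; simpc => /=.
rewrite inner_truncated_drift//.
pose S1 : set (Rvec R d) := [set y | 1 < enorm y <= h].
pose S2 : set (Rvec R d) := [set y | h < enorm y <= 1].
pose f1 : Rvec R d -> R := (fun y => sin (inner u y) - inner u y) \_ small.
pose f2 : Rvec R d -> R := (fun y => sin (inner u y)) \_ large.
pose f3 : Rvec R d -> R := inner u \_ S1.
pose f4 : Rvec R d -> R := inner u \_ S2.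
have i1 : nu.-integrable setT (EFin \o f1).
  apply: integrable_patch; first exact: measurable_small.
  exact: integrable_sinB_inner.
have i2 : nu.-integrable setT (EFin \o f2).
  apply: integrable_patch; first exact: measurable_large.
  exact: integrable_sin_inner.
have i3 : nu.-integrable setT (EFin \o f3).
  apply: integrable_patch; first exact: measurable_shell.
  exact: integrable_inner_shell.
have i4 : nu.-integrable setT (EFin \o f4).
  apply: integrable_patch; first exact: measurable_shell.
  exact: integrable_inner_shell.
rewrite /small_phase /large_phase.
rewrite (Rintegral_mkcond _ S1) (Rintegral_mkcond _ S2).
rewrite (Rintegral_mkcond _ small) (Rintegral_mkcond _ large).
rewrite -/f1 -/f2 -/f3 -/f4.
have i12 : nu.-integrable setT (EFin \o (fun y => f1 y + f2 y)).
  by have := integrableD measurableT i1 i2; exact: eq_integrable.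
have i34 : nu.-integrable setT (EFin \o (fun y => f3 y - f4 y)).
  by have := integrableB measurableT i3 i4; exact: eq_integrable.
transitivity (inner u b + \int[nu]_y ((f1 y + f2 y) + (f3 y - f4 y)));
  last first.
  rewrite RintegralD// RintegralD// RintegralB//; ring.
congr (_ + _).
apply: eq_Rintegral => y _.
rewrite !(mulr0, mul0r, subr0, add0r, mul1r, addr0, oppr0, expR0).
rewrite /f1 /f2 /f3 /f4 !patch_indic /= !indicE.
have E (p : Rvec R d -> bool) : (y \in [set z | p z]) = p y.
  by apply/idP/idP; rewrite inE.
rewrite /small /large /S1 /S2 !E.
by case: (leP (enorm y) 1) => _; case: (leP (enorm y) h) => _ /=; ring.
Qed.

Lemma cf_decay_ge0 u : 0 <= A u.
Proof. by apply: Rintegral_ge0 => y _; rewrite subr_ge0 cos_le1. Qed.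

(** Quadratic for the small jumps, where 1 - cos x <= x^2 / 2; kept as it is for
    the large ones, so that its average over u is at most the mass of nu
    there. *)
Lemma cf_decay_le u : A u <= (\int[nu]_(y in small) (inner u y ^+ 2)) / 2
  + \int[nu]_(y in large) (1 - cos (inner u y)).
Proof.
rewrite /cf_decay Rintegral_small_large; last exact: integrable_onem_cos.
rewrite lerD2r -RintegralZr; last 2 first.
- exact: measurable_small.
- exact: integrable_sqr_inner.
have mS : measurable small := measurable_small h.
apply: le_Rintegral => //.
- exact: integrable_onem_cos.
- have := integrableZr mS (2^-1) (integrable_sqr_inner h levy_nu u).
  exact: eq_integrable.
- by move=> y _; exact: onem_cos_le.
Qed.

Lemma small_phase_le u :
  `|theta1 u| <= (\int[nu]_(y in small) (inner u y ^+ 2)) / 2.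
Proof.
have mS : measurable small := measurable_small h.
have i1 := integrable_sinB_inner h levy_nu u.
rewrite (le_trans (le_normr_Rintegral mS i1))// -RintegralZr//; last first.
  exact: integrable_sqr_inner.
apply: le_Rintegral => //.
- exact: integrable_norm.
- have := integrableZr mS (2^-1) (integrable_sqr_inner h levy_nu u).
  exact: eq_integrable.
- by move=> y _; exact: normr_sinB_le.
Qed.

Lemma large_phase_le u : `|theta2 u| <= fine (tail nu h).
Proof.
have mL : measurable large := measurable_large h.
have i1 := integrable_sin_inner levy_nu h0 u.
rewrite (le_trans (le_normr_Rintegral mL i1))//.
rewrite -[leRHS]mul1r -(Rintegral_cst nu mL); apply: le_Rintegral => //.
- exact: integrable_norm.
- apply: (levy_integrable levy_nu (k := 1 + h ^- 2)) => //.
  by move=> y /ltW hy; rewrite normr1 one_le_trunc.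
- by move=> y _; exact: sin_max.
Qed.

End exponent.

(** * The characteristic function after centering *)

Section centered_characteristic_function.
Context {R : realType} {d : nat}.
Variables (b : 'rV[R]_d) (nu : {measure set (Rvec R d) -> \bar R}) (h t : R).
Hypotheses (levy_nu : levy_measure nu) (h0 : 0 < h) (t0 : 0 <= t).
Context {disp : measure_display} {T : measurableType disp}.
Variables (P : probability T R) (X : R -> {RV P >-> Rvec R d}).
Hypothesis tripletX : levy_triplet X b nu.

Local Notation A := (cf_decay nu).
Local Notation theta1 := (small_phase nu h).
Local Notation theta2 := (large_phase nu h).

(** The compensation by t * drift removes from the characteristic exponent the
    term that is linear in u. *)
Definition centered (w : T) : 'rV[R]_d :=
  (X t w : 'rV[R]_d) - t *: truncated_drift b nu h.

Lemma integrable_bounded1 (f : T -> R) : measurable_fun setT f ->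
  (forall w, `|f w| <= 1) -> P.-integrable setT (EFin \o f).
Proof.
move=> mf f1.
apply: (@le_integrable _ _ _ P setT measurableT (EFin \o f) (cst 1%:E)).
- exact/measurable_EFinP.
- by move=> w _ /=; rewrite normr1 lee_fin.
- exact: finite_measure_integrable_cst.
Qed.

(** The cosine transform of the centered variable: the real part of
    exp (- i t <u, drift>) times the characteristic function of X_t. *)
Lemma centered_cf u : \int[P]_w cos (inner u (centered w)) =
  expR (- (t * A u)) * cos (t * (theta1 u + theta2 u)).
Proof.
have := tripletX u t0.
have := Re_levy_exponent b levy_nu u; have := Im_levy_exponent b levy_nu h0 u.
case: levy_exponent => eR eI /= -> -> /eqP.
rewrite eq_complex => /andP[/eqP/= Hc /eqP/= Hs].
pose a := t * inner u (truncated_drift b nu h).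
have mcos : measurable_fun setT (fun w : T => cos (inner u (X t w))).
  exact: (measurableT_comp (measurable_cos_inner u)).
have msin : measurable_fun setT (fun w : T => sin (inner u (X t w))).
  exact: (measurableT_comp (measurable_sin_inner u)).
have icos := integrable_bounded1 mcos (fun w => cos_max _).
have isin := integrable_bounded1 msin (fun w => sin_max _).
have {}Hc : \int[P]_w cos (inner u (X t w)) =
    expR (- (t * A u)) * cos (a + t * (theta1 u + theta2 u)).
  transitivity (\int[P]_w
    complex.Re (cexp ('i * (inner u (X t w))%:C)%C)).
    by apply: eq_Rintegral => w _; rewrite cexp_iM.
  rewrite Hc /a; congr (expR _ * cos _); ring.
have {}Hs : \int[P]_w sin (inner u (X t w)) =
    expR (- (t * A u)) * sin (a + t * (theta1 u + theta2 u)).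
  transitivity (\int[P]_w
    complex.Im (cexp ('i * (inner u (X t w))%:C)%C)).
    by apply: eq_Rintegral => w _; rewrite cexp_iM.
  rewrite Hs /a; congr (expR _ * sin _); ring.
transitivity (\int[P]_w (cos (inner u (X t w)) * cos a +
    sin (inner u (X t w)) * sin a)).
  by apply: eq_Rintegral => w _; rewrite /centered innerBr innerZr cosB.
have icos' : P.-integrable setT
    (EFin \o (fun w => cos (inner u (X t w)) * cos a)).
  by have := integrableZr measurableT (cos a) icos; exact: eq_integrable.
have isin' : P.-integrable setT
    (EFin \o (fun w => sin (inner u (X t w)) * sin a)).
  by have := integrableZr measurableT (sin a) isin; exact: eq_integrable.
rewrite RintegralD//.
rewrite !RintegralZr// Hc Hs -!mulrA -mulrDr -cosB; congr (_ * cos _); ring.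
Qed.

Let Q u := \int[nu]_(y in [set y : Rvec R d | enorm y <= h]) (inner u y ^+ 2).
Let J u :=
  \int[nu]_(y in [set y : Rvec R d | h < enorm y]) (1 - cos (inner u y)).

(** A lower bound that is affine in the integrals Q and J, so that averaging
    over u reaches the integrands.  With E = exp (- t decay), the identity
    E C = E - (1 - C) + (1 - E) (1 - C) separates decay and phase.  The small
    phase is absorbed by the Lipschitz bound of the cosine, and the large one,
    at most 1/4, costs (1/4)^2 / 2 = 1/32. *)
Lemma centered_cf_ge u : t * fine (tail nu h) <= 1 / 4 ->
  25 / 36 * (4 / 3 - t * (Q u / 2 + J u)) - t * Q u / 2 - 1 / 32 <=
  \int[P]_w cos (inner u (centered w)).
Proof.
move=> tail4; rewrite centered_cf.
have a0 : 0 <= t * A u by rewrite mulr_ge0// cf_decay_ge0.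
have aQJ : t * A u <= t * (Q u / 2 + J u).
  by rewrite ler_wpM2l// cf_decay_le.
have := expRN_ge_tangent (t * A u); set E := expR _ => Ege.
have E1 : E <= 1 by rewrite -expR0 ler_expR oppr_le0.
have E0 : 0 <= E by exact: expR_ge0.
have th1 : `|t * theta1 u| <= t * Q u / 2.
  by rewrite normrM (ger0_norm t0) -mulrA ler_wpM2l// small_phase_le.
have th2 : `|t * theta2 u| <= 1 / 4.
  rewrite normrM (ger0_norm t0) (le_trans _ tail4)// ler_wpM2l//.
  exact: large_phase_le.
have c2 := onem_cos_le (t * theta2 u).
have s2 : (t * theta2 u) ^+ 2 <= 1 / 16.
  rewrite -real_normK ?num_real//; have := normr_ge0 (t * theta2 u); nra.
have := cos_sub_le (t * theta2 u) (t * (theta1 u + theta2 u)).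
rewrite -mulrBr opprD addrCA subrr addr0 mulrN normrN.
set C := cos (t * (_ + _)) => c1.
have C1 : C <= 1 by exact: cos_le1.
have : 0 <= (1 - E) * (1 - C) by rewrite mulr_ge0 ?subr_ge0.
lra.
Qed.

(** If the random direction u has covariance s * Id then <u,y>^2 averages to
    s |y|^2, whence t Q averages to s t V(h) <= 1/6, independently of the
    dimension.  And 1 - cos <u,y> averages to at most 1, whence t J averages to
    at most t nu(|y| > h) <= 1/4.  The argument of the tangent line is then at
    most 1/12 + 1/4 = 1/3. *)
Lemma sign_average_centered_cf L (s : R) :
  t * fine (tail nu h) <= 1 / 4 -> t * (s * trunc_var nu h) <= 1 / 6 ->
  (forall y, \sum_(v <- L) inner v y ^+ 2 = s * enorm y ^+ 2) ->
  (forall y, 0 <= \prod_(v <- L) cos (inner v y)) ->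
  25 / 36 - 1 / 12 - 1 / 32 <=
  sign_average L (fun u => \int[P]_w cos (inner u (centered w))).
Proof.
move=> tail4 var6 sumL prodL.
have mS := @measurable_small R d h; have mL := @measurable_large R d h.
have avgQ : sign_average L Q = s * trunc_var nu h.
  have [_ ->] := sign_average_Rintegral L mS (integrable_sqr_inner h levy_nu).
  rewrite /trunc_var -RintegralZl//; last first.
    apply: (levy_integrable levy_nu (k := 1 + h ^+ 2)) => //.
      by apply: measurable_funX; exact: measurable_enorm.
    by move=> y yh; rewrite ger0_norm ?sqr_ge0// sqr_enorm_le_trunc.
  by apply: eq_Rintegral => y _; rewrite sign_average_sqr sumL.
have avgJ : sign_average L J <= fine (tail nu h).
  have [i1 ->] := sign_average_Rintegral L mL
    (fun u => integrable_onem_cos levy_nu u mL).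
  rewrite -[leRHS]mul1r -(Rintegral_cst nu mL); apply: le_Rintegral => //.
    apply: (levy_integrable levy_nu (k := 1 + h ^- 2)) => //.
    by move=> y /ltW hy; rewrite normr1 one_le_trunc.
  move=> y _.
  have -> : sign_average L (fun u => 1 - cos (inner u y)) =
      1 - \prod_(v <- L) cos (inner v y).
    rewrite -sign_average_cos -[X in _ = X - _](sign_average_cst L).
    rewrite -[X in _ = _ + X]mulN1r -sign_averageZ -sign_averageD.
    by apply: eq_sign_average => u; rewrite mulN1r.
  by have := prodL y; lra.
apply: le_trans (ler_sign_average L (fun u => centered_cf_ge u tail4)).
have -> : sign_average L (fun u => 25 / 36 * (4 / 3 - t * (Q u / 2 + J u))
    - t * Q u / 2 - 1 / 32) = sign_average L (fun u =>
      25 / 36 * (4 / 3) - 1 / 32 +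
      (- (25 / 72 + 1 / 2) * t * Q u + - (25 / 36 * t) * J u)).
  by apply: eq_sign_average => u; field.
rewrite sign_averageD sign_average_cst sign_averageD !sign_averageZ avgQ.
have := ler_wpM2l t0 avgJ; lra.
Qed.

End centered_characteristic_function.

(** * From characteristic functions to tails *)

Section tail_from_averages.
Context {R : realType} {d : nat}.
Implicit Types (y : 'rV[R]_d).

Lemma prod_cos_le1 (L : seq 'rV[R]_d) y :
  \prod_(v <- L) cos (inner v y) <= 1.
Proof.
rewrite -sign_average_cos -(sign_average_cst L 1).
by apply: ler_sign_average => u; exact: cos_le1.
Qed.

(** A discrete stand-in for a centered Gaussian vector of covariance s * Id.
    Each scaled basis vector is repeated 2n times: evenness makes the products
    of cosines nonnegative, and n >= s M^2 brings every argument of a cosine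
    below 1 on the ball of radius M, where [cos_le_expR] applies. *)
Lemma gaussian_directions (s M : R) : 0 <= s -> exists L : seq 'rV[R]_d,
  [/\ forall y, \sum_(v <- L) inner v y ^+ 2 = s * enorm y ^+ 2,
      forall y, 0 <= \prod_(v <- L) cos (inner v y) &
      forall y, enorm y <= M ->
        \prod_(v <- L) cos (inner v y) <= expR (- (s * enorm y ^+ 2 / 2))].
Proof.
move=> s0; pose n := (Num.truncn (s * M ^+ 2)).+1.
have nM : s * M ^+ 2 <= n%:R.
  by apply/ltW; rewrite truncnS_gt.
have n0 : 0 < n%:R :> R by rewrite ltr0n.
have n20 : 0 < n.*2%:R :> R by rewrite -mul2n natrM mulr_gt0.
pose sc := Num.sqrt (s / n.*2%:R).
have sc2 : sc ^+ 2 = s / n.*2%:R by rewrite sqr_sqrtr// divr_ge0// ltW.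
pose L := [seq sc *: canonical_vec k | i <- enum 'I_n.*2, k <- enum 'I_d].
have innerL k y : inner (sc *: canonical_vec k) y = sc * y ord0 k.
  by rewrite innerZl inner_canonical_vec.
have sumL y : \sum_(v <- L) inner v y ^+ 2 = s * enorm y ^+ 2.
  rewrite /L big_allpairs_dep/= big_enum/= sumr_const card_ord.
  rewrite big_enum/=; under eq_bigr do rewrite innerL exprMn sc2 expr2.
  by rewrite -mulr_sumr sqr_enorm -[LHS]mulr_natr mulrAC divfK// gt_eqF.
have prodL y : \prod_(v <- L) cos (inner v y) =
    (\prod_(k < d) cos (sc * y ord0 k)) ^+ n.*2.
  rewrite /L big_allpairs_dep/= big_enum/= prodr_const card_ord big_enum/=.
  by congr (_ ^+ _); apply: eq_bigr => k _; rewrite innerL.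
exists L; split => [//|y|y yM].
  by rewrite prodL -mul2n exprM exprn_ge0// sqr_ge0.
have -> : expR (- (s * enorm y ^+ 2 / 2)) =
    (\prod_(k < d) expR (- ((sc * y ord0 k) ^+ 2 / 2))) ^+ n.*2.
  rewrite -expR_sum -expRM_natl; congr expR.
  rewrite sumrN -mulr_suml mulrN; congr (- _).
  under eq_bigr do rewrite exprMn sc2 expr2.
  rewrite -mulr_sumr sqr_enorm /inner; field; rewrite gt_eqF//.
rewrite prodL.
have cosP k : 0 <= cos (sc * y ord0 k) <= expR (- ((sc * y ord0 k) ^+ 2 / 2)).
  apply: cos_le_expR; rewrite -(@ler_pXn2r _ 2) ?nnegrE// expr1n.
  rewrite real_normK ?num_real// exprMn sc2 mulrAC ler_pdivrMr// mul1r.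
  apply: (@le_trans _ _ n%:R); last by rewrite -addnn ler_nat leq_addr.
  rewrite (le_trans _ nM)// ler_wpM2l// -real_normK ?num_real//.
  rewrite ler_pXn2r ?nnegrE//; last first.
    by rewrite (le_trans _ yM)// enorm_ge0.
  by rewrite (le_trans (normr_coord_le _ _)).
rewrite lerXn2r ?nnegrE//.
- by apply: prodr_ge0 => k _; have /andP[] := cosP k.
- by apply: prodr_ge0 => k _; exact: expR_ge0.
- by apply: ler_prod => k _; exact: cosP.
Qed.

Context {disp : measure_display} {T : measurableType disp}.
Variables (P : probability T R) (W : T -> 'rV[R]_d).
Hypothesis mW : measurable_fun setT (W : T -> Rvec R d).

Lemma measurable_enorm_W : measurable_fun setT (fun w => enorm (W w)).
Proof. exact: (measurableT_comp measurable_enorm mW). Qed.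

Lemma sign_average_cf L :
  P.-integrable setT (EFin \o (fun w => \prod_(v <- L) cos (inner v (W w)))) /\
  sign_average L (fun u => \int[P]_w cos (inner u (W w))) =
  \int[P]_w \prod_(v <- L) cos (inner v (W w)).
Proof.
have ic u : P.-integrable setT (EFin \o (fun w => cos (inner u (W w)))).
  apply: integrable_bounded1 => [|w]; last exact: cos_max.
  exact: (measurableT_comp (measurable_cos_inner u) mW).
have [i1 ->] := sign_average_Rintegral L measurableT ic.
split.
  by apply: eq_integrable i1 => // w _ /=; rewrite sign_average_cos.
by apply: eq_Rintegral => w _; rewrite sign_average_cos.
Qed.

(** For L as in [gaussian_directions], the kernel K(y), the product of the
    cosines of <v,y>, is at most 1 everywhere and at most exp (- s r^2 / 2) on
    r < |y| <= M; its expectation is the average of the cosine transform, at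
    least beta.  This bounds P(r < |W| <= M) uniformly in M, and M tends to
    infinity. *)
Lemma tail_le_of_cf (s r beta : R) : 0 <= s -> 0 <= r ->
  (forall L, (forall y, \sum_(v <- L) inner v y ^+ 2 = s * enorm y ^+ 2) ->
    (forall y, 0 <= \prod_(v <- L) cos (inner v y)) ->
    beta <= sign_average L (fun u => \int[P]_w cos (inner u (W w)))) ->
  ((1 - expR (- (s * r ^+ 2 / 2)))%:E * P [set w | (r < enorm (W w))%R] <=
     (1 - beta)%:E)%E.
Proof.
move=> s0 r0 cf; set q := 1 - expR _.
have q0 : 0 <= q.
  rewrite subr_ge0 -expR0 ler_expR oppr_le0 divr_ge0// mulr_ge0//.
  exact: sqr_ge0.
pose E (n : nat) := [set w | r < enorm (W w) <= n%:R].
have mE n : measurable (E n).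
  rewrite (_ : E n = (fun w => enorm (W w)) @^-1` `]r, n%:R]).
    by rewrite -[X in measurable X]setTI; apply: measurable_enorm_W.
  by apply/seteqP; split => w; rewrite /= in_itv.
have UE : [set w | r < enorm (W w)] = \bigcup_n E n.
  apply/seteqP; split => [w /= rw|w [n _ /= /andP[]]//].
  exists (Num.truncn (enorm (W w))).+1 => //; apply/andP; split => //.
  by apply/ltW; rewrite truncnS_gt.
have ndE : nondecreasing_seq E.
  move=> m n mn; apply/subsetPset => w /= /andP[rw wm]; apply/andP; split => //.
  by rewrite (le_trans wm)// ler_nat.
have mUE : measurable (\bigcup_n E n) by exact: bigcupT_measurable.
have EP n : (q%:E * P (E n) <= (1 - beta)%:E)%E.
  have [L [sumL prodL gaussL]] := gaussian_directions n%:R s0.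
  have [iK avgK] := sign_average_cf L.
  have PE : P (E n) = (fine (P (E n)))%:E by rewrite fineK// fin_num_measure.
  have iE : P.-integrable setT (EFin \o (fun w => 1 - q * \1_(E n) w)).
    have i1 : P.-integrable setT (EFin \o (fun=> 1 : R)).
      exact: finite_measure_integrable_cst.
    have := integrableB measurableT i1
      (integrableZl measurableT q (integrable_indic P (mE n))).
    exact: eq_integrable.
  rewrite PE -EFinM lee_fin lerBrDl -lerBrDr.
  rewrite (le_trans (cf L sumL prodL))// avgK.
  apply: (@le_trans _ _ (\int[P]_w (1 - q * \1_(E n) w))).
    apply: le_Rintegral => // w _; rewrite indicE.
    have [|wE] := boolP (w \in E n); last first.
      by rewrite mulr0 subr0 prod_cos_le1.
    rewrite inE /E/= => /andP[rw wn]; rewrite mulr1 /q opprB addrC subrK.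
    rewrite (le_trans (gaussL _ wn))// ler_expR lerN2 ler_pM2r//.
    rewrite ler_wpM2l// ler_pXn2r ?nnegrE ?enorm_ge0//; exact: ltW.
  rewrite RintegralB//; last 2 first.
  - exact: finite_measure_integrable_cst.
  - have := integrableZl measurableT q (integrable_indic P (mE n)).
    exact: eq_integrable.
  rewrite RintegralZl//; last exact: integrable_indic.
  rewrite Rintegral_cst// mul1r -[leRHS]/(fine 1%E - _) -(probability_setT P).
  by rewrite /Rintegral integral_indic// setIT.
have cE := nondecreasing_cvg_mu mE mUE ndE.
rewrite UE.
have cqE := cvgeZl (isT : q%:E \is a fin_num) (cE _ P).
by apply: (cvge_to_le cqE); apply: nearW => n; exact: EP.
Qed.

End tail_from_averages.

(** * The median *)

Section median_bound.
Context {R : realType} {d : nat}.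

(** There are x >= h arbitrarily close to h with V(x) = x^2 c / t, and V is
    nondecreasing, so V(h) <= x^2 c / t for these x. *)
Lemma trunc_var_hc_le (nu : {measure set (Rvec R d) -> \bar R}) (c t h : R) :
  levy_measure nu -> 0 < c -> 0 < t -> hc nu c t = h%:E -> 0 < h ->
  t * trunc_var nu h <= h ^+ 2 * c.
Proof.
move=> levy_nu c0 t0 hch h0.
have V0 : 0 <= trunc_var nu h by apply: Rintegral_ge0 => y _; exact: sqr_ge0.
have tVc0 : 0 <= t * trunc_var nu h / c.
  by rewrite divr_ge0 ?(ltW c0)// mulr_ge0// ltW.
suff : Num.sqrt (t * trunc_var nu h / c) <= h.
  rewrite -(@ler_pXn2r _ 2) ?nnegrE ?sqrtr_ge0 ?(ltW h0)//.
  by rewrite sqr_sqrtr// ler_pdivrMr.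
apply/ler_addgt0Pr => e e0.
have : (hc nu c t < (h + e)%:E)%E by rewrite hch lte_fin ltrDl.
move=> /ereal_inf_lt[_ [x [x0 Vx] <-]]; rewrite lte_fin => xhe.
have hx : h <= x.
  by rewrite -lee_fin -hch; apply: ereal_inf_lbound; exists x.
have iV (r : R) : nu.-integrable [set y : Rvec R d | enorm y <= r]
    (EFin \o (fun y => enorm y ^+ 2)).
  apply: (levy_integrable levy_nu (k := 1 + r ^+ 2)).
  - exact: measurable_small.
  - by apply: measurable_funX; exact: measurable_enorm.
  - by move=> y yr; rewrite ger0_norm ?sqr_ge0// sqr_enorm_le_trunc.
have VhVx : trunc_var nu h <= trunc_var nu x.
  rewrite /trunc_var /Rintegral fine_le//.
  - by apply: integrable_fin_num => //; exact: measurable_small.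
  - by apply: integrable_fin_num => //; exact: measurable_small.
  apply: ge0_subset_integral => //.
  - exact: measurable_small.
  - exact: measurable_small.
  - exact: (measurable_int _ (iV x)).
  - by move=> y _; rewrite lee_fin sqr_ge0.
  - by move=> y /= /le_trans; apply.
rewrite (le_trans _ (ltW xhe))// -(ger0_norm (ltW x0)) -sqrtr_sqr ler_wsqrtr//.
rewrite ler_pdivrMr//.
have -> : x ^+ 2 * c = t * trunc_var nu x.
  have -> : trunc_var nu x = x ^+ 2 * (c / t).
    by rewrite -Vx mulrCA divff ?mulr1// gt_eqF// exprn_gt0.
  by rewrite mulrCA [t * _]mulrC divfK// gt_eqF.
by rewrite ler_pM2l.
Qed.

Context {disp : measure_display} {T : measurableType disp}.
Variable P : probability T R.

(** If m were farther from f 0, one of the two events that define the median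
    would lie in the event r < |Y - a|, whose probability is below 1/2. *)
Lemma median_lipschitz1 (Y : T -> 'rV[R]_d) (a : 'rV[R]_d) (f : 'rV[R]_d -> R)
    (r m : R) : measurable_fun setT (Y : T -> Rvec R d) -> lipschitz1 f ->
  (P [set w | (r < enorm (Y w - a))%R] < 2^-1%:E)%E ->
  is_median P (fun w => f (Y w)) m -> `|m - f 0| <= r + enorm a.
Proof.
move=> mY lf tailP [mle mge].
have mf : measurable_fun setT (fun w => f (Y w)).
  apply: (measurableT_comp _ mY).
  by apply: continuous_measurable_Rvec; exact: lipschitz1_continuous.
have mtail : measurable [set w | r < enorm (Y w - a)].
  rewrite (_ : mkset _ = (fun w => enorm (Y w - a)) @^-1` `]r, +oo[).
    rewrite -[X in measurable X]setTI.
    by apply: (measurableT_comp (measurable_enormB a) mY).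
  by apply/seteqP; split => w; rewrite /= in_itv/= andbT.
have far w : r + enorm a < `|f (Y w) - f 0| -> r < enorm (Y w - a).
  move=> H; have := lf (Y w) 0; rewrite subr0.
  by have := enormD (Y w - a) a; rewrite subrK; lra.
have small_event (B : set T) : measurable B ->
    (forall w, B w -> r + enorm a < `|f (Y w) - f 0|) ->
    (P B < 2^-1%:E)%E.
  move=> mB Bfar; apply: le_lt_trans tailP.
  by apply: le_measure; rewrite ?inE// => w /Bfar/far.
rewrite ler_norml; apply/andP; split; rewrite leNgt; apply/negP => mfar.
- move: mle; rewrite leNgt => /negP; apply; apply: small_event => [|w /= fm].
    rewrite (_ : mkset _ = (fun w => f (Y w)) @^-1` `]-oo, m]).
      by rewrite -[X in measurable X]setTI; apply: mf.
    by apply/seteqP; split => w; rewrite /= in_itv.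
  by rewrite distrC (lt_le_trans _ (ler_norm _))//; lra.
- move: mge; rewrite leNgt => /negP; apply; apply: small_event => [|w /= fm].
    rewrite (_ : mkset _ = (fun w => f (Y w)) @^-1` `[m, +oo[).
      by rewrite -[X in measurable X]setTI; apply: mf.
    by apply/seteqP; split => w; rewrite /= in_itv/= andbT.
  by rewrite (lt_le_trans _ (ler_norm _))//; lra.
Qed.

End median_bound.

(** By [gc_sqr_ge] the exponent is at least (3/4) * 2 ln 4 = 3 ln 2. *)
Lemma expR_gc_le (R : realType) (c : R) : 0 < c ->
  expR (- (3 / 4 * (gc c 4^-1 ^+ 2 / c))) <= 1 / 8.
Proof.
move=> c0.
have e8 : expR (- (3 * ln 2)) = 1 / 8 :> R.
  rewrite expRN; have -> : 3 * ln 2 = ln (2 ^+ 3) :> R.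
    by rewrite lnXn// mulr_natl.
  by rewrite lnK ?posrE ?exprn_gt0//; field.
rewrite -e8 ler_expR lerN2.
have := gc_sqr_ge (x := 4^-1) c0.
have -> : - ln 4^-1 = 2 * ln 2 :> R.
  rewrite lnV ?posrE// opprK; have -> : 4 = 2 ^+ 2 :> R by ring.
  by rewrite lnXn// mulr_natl.
have q0 : 0 < 4^-1 :> R by rewrite invr_gt0.
have q1 : 4^-1 <= 1 :> R by rewrite invf_le1// ler1n.
move=> /(_ q0 q1) H.
have : 2 * (2 * ln 2) <= gc c 4^-1 ^+ 2 / c by rewrite ler_pdivlMr//; lra.
lra.
Qed.

(** The variance parameter s is chosen so that s t V(h) <= s h^2 c = 1/6, and
    then s r^2 / 2 = (3/4) g^2 / c for r = 3 h g.  So [tail_le_of_cf] gives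
    (7/8) P <= 1 - (25/36 - 1/12 - 1/32) = 121/288, that is
    P <= 121/252 < 1/2. *)
Lemma centered_tail_lt_half (R : realType) (d : nat) (disp : measure_display)
    (T : measurableType disp) (P : probability T R)
    (X : R -> {RV P >-> Rvec R d}) (b : 'rV[R]_d)
    (nu : {measure set (Rvec R d) -> \bar R}) (c t h : R) :
  levy_measure nu -> levy_triplet X b nu ->
  0 < c -> 0 < t -> 0 < h -> t * trunc_var nu h <= h ^+ 2 * c ->
  t * fine (tail nu h) <= 1 / 4 ->
  (P [set w | (3 * h * gc c 4^-1 < enorm (centered b nu h t X w))%R]
    < 2^-1%:E)%E.
Proof.
move=> levy_nu tripletX c0 t0 h0 Vh tail4.
set g := gc c 4^-1.
have q0 : 0 < 4^-1 :> R by rewrite invr_gt0.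
have q1 : 4^-1 <= 1 :> R by rewrite invf_le1// ler1n.
have [g0 _] := gcP c0 q0 q1.
have mW : measurable_fun setT (centered b nu h t X : T -> Rvec R d).
  apply: (@measurability _ _ T (Rvec R d) setT _ (@open 'rV[R]_d) erefl).
  move=> _ [U oU <-]; rewrite setTI.
  have cB : continuous (fun y : 'rV[R]_d => y - t *: truncated_drift b nu h).
    move=> y; apply: (@continuousB R _ 'rV[R]_d id (fun=> _)).
      exact: cvg_id.
    exact: cst_continuous.
  have mU : measurable ((fun y => y - t *: truncated_drift b nu h) @^-1` U
      : set (Rvec R d)).
    by apply: sub_sigma_algebra; move/continuousP : cB; apply.
  exact: (measurable_funPTI (X t) mU).
pose s := (6 * h ^+ 2 * c)^-1.
have s0 : 0 < s by rewrite invr_gt0 !mulr_gt0// exprn_gt0.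
have r0 : 0 <= 3 * h * g by rewrite !mulr_ge0// ltW.
have svar : t * (s * trunc_var nu h) <= 1 / 6.
  rewrite mulrCA /s mulrC ler_pdivrMr ?mulr_gt0 ?exprn_gt0//; lra.
have := tail_le_of_cf mW (ltW s0) r0 (fun L sumL prodL =>
  sign_average_centered_cf levy_nu h0 (ltW t0) tripletX tail4 svar sumL prodL).
have -> : s * (3 * h * g) ^+ 2 / 2 = 3 / 4 * (g ^+ 2 / c).
  by rewrite /s; field; rewrite !gt_eqF.
have := expR_gc_le c0; rewrite -/g.
set e := expR _ => e8.
set E := mkset _.
have PE : P E = (fine (P E))%:E.
  rewrite fineK// fin_num_measure//.
  rewrite (_ : E =
      (fun w => enorm (centered b nu h t X w)) @^-1` `]3 * h * g, +oo[).
    by rewrite -[X in measurable X]setTI; apply: measurable_enorm_W.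
  by apply/seteqP; split => w; rewrite /= in_itv/= andbT.
have p0 : 0 <= fine (P E) by rewrite fine_ge0.
rewrite PE -EFinM lee_fin lte_fin; move: (fine (P E)) p0 => p p0.
nra.
Qed.

Theorem theorem1 (R : realType) (d : nat) (disp : measure_display)
    (T : measurableType disp) (P : probability T R)
    (X : R -> {RV P >-> Rvec R d}) (b : 'rV[R]_d)
    (nu : {measure set (Rvec R d) -> \bar R})
    (f : 'rV[R]_d -> R) (c t h m : R) :
  levy_process X ->
  levy_measure nu ->
  nu [set: Rvec R d] <> 0%E ->
  levy_triplet X b nu ->
  lipschitz1 f ->
  0 < c ->
  0 < t ->
  hc nu c t = h%:E -> 0 < h ->
  (t%:E * tail nu h <= (4^-1)%:E)%E ->
  is_median P (fun w => f (X t w)) m ->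
  `|m - f 0| <= h * (1 + 3 * gc c 4^-1) + Ec nu b t h.
Proof.
move=> _ levy_nu _ tripletX lf c0 t0 hch h0 tail4 med.
have tailR : t * fine (tail nu h) <= 1 / 4.
  have tail_fin : tail nu h \is a fin_num.
    rewrite ge0_fin_numE ?measure_ge0//.
    move: tail4; case: (tail nu h) => [r||]//=.
    + by rewrite ltry.
    + by rewrite gt0_muley ?lte_fin.
  by move: tail4; rewrite -(fineK tail_fin) -EFinM lee_fin/= div1r.
have Vh := trunc_var_hc_le levy_nu c0 t0 hch h0.
have := centered_tail_lt_half levy_nu tripletX c0 t0 h0 Vh tailR.
move=> /(@median_lipschitz1 _ _ _ _ P (X t)) H.
have mXt : measurable_fun setT (X t : T -> Rvec R d) by [].
apply: le_trans (H f m mXt lf med) _.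
rewrite EcE enormZ (ger0_norm (ltW t0)) lerD2r; lra.
Qed.
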